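(* Let $(M,h)$ be a Hermitian manifold of complex dimension $n\ge2$. Then the conformal solution $F$ of the generalized Zermelo navigation problem with data $(h,\|u\|_h,W)$ and the metric $h$ are projectively related if and only if $F$ and $h$ are homothetic.
   Context: $M$ is a connected complex manifold with local coordinates $z=(z^k)$; $(z,\eta)$ are the induced coordinates on the holomorphic tangent bundle $T'M$; summation convention; $\dot\partial_k=\partial/\partial\eta^k$; barred indices denote conjugates. Conformal solution: the data are a Hermitian metric $h$ on $M$, a smooth section $W$ of $T'M$ (the wind) and a smooth function $\|u\|_h$ on $M$ with $\|W\|_h<\|u\|_h\le1$, where $\|\eta\|_h=\sqrt{h_{i\bar j}\eta^i\bar\eta^j}$. In either of the two cases ''$W=0$'' or ''$W$ nowhere zero and $\cos\varphi=0$'' (where $\varphi=\arg h(v,\bar W)$ is the constant angle, $v$ being the resultant velocity; $\cos\varphi=0$ means that $v$ and $W$ are orthogonal), the solution of the generalized Zermelo navigation problem is the Hermitian metric $F(z,\eta)=\rho(z)\|\eta\|_h$ with $\rho=\frac{1}{\|u\|_h}$ in the first case, and $\rho=\frac{1}{\sqrt{\tilde\varepsilon}}$, $\tilde\varepsilon=\|u\|_h^2-\|W\|_h^2$, in the second. $F$ and $h$ are homothetic if $\rho$ is constant. For a metric $F$ with fundamental tensor $g_{i\bar j}=\frac{\partial^2F^2}{\partial\eta^i\partial\bar\eta^j}$, put $N^i_j=g^{\bar m i}\frac{\partial g_{l\bar m}}{\partial z^j}\eta^l$, $L^i_{jk}=\dot\partial_jN^i_k$, $G^i=\frac12N^i_j\eta^j$,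 $\theta^{*i}=g^{\bar mi}g_{h\bar p}(L^{\bar p}_{\bar j\bar m}-L^{\bar p}_{\bar m\bar j})\eta^h\bar\eta^j$ (with $L^{\bar p}_{\bar j\bar m}=\overline{L^p_{jm}}$). Two metrics $F,\tilde F$ on $M$ are projectively related if they have the same complex geodesics as point sets, equivalently $\tilde G^i=G^i+\frac12(\tilde\theta^{*i}-\theta^{*i})+P\eta^i$ for some smooth complex-valued function $P$ on $T'M\setminus0$. *)

(* Defs.v *)
From HB Require Import structures.
From mathcomp Require Import all_boot all_order all_algebra.
From mathcomp Require Import all_classical all_reals all_analysis.
From mathcomp Require Import complex ring.

Set Implicit Arguments.
Unset Strict Implicit.
Unset Printing Implicit Defensive.

Import Order.TTheory GRing.Theory Num.Theory.
Import numFieldNormedType.Exports.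

Local Open Scope classical_set_scope.
Local Open Scope ring_scope.
Local Open Scope complex_scope.

(* the usual topology and norm of the complex numbers *)
#[export, non_forgetful_inheritance]
HB.instance Definition _ (R : realType) := GRing.ComAlgebra.copy R[i] R[i]^o.
#[export, non_forgetful_inheritance]
HB.instance Definition _ (R : realType) := Vector.copy R[i] R[i]^o.
#[export, non_forgetful_inheritance]
HB.instance Definition _ (R : realType) := NormedModule.copy R[i] R[i]^o.

(** * Real differentiation of complex-valued functions

    In a normed module over [R[i]], MathComp-Analysis' derivatives are complex
    derivatives.  The derivatives below are along real lines, so that they
    apply to functions which are not holomorphic. *)
Section RealCalculus.
Variables (R : realType) (V : normedModType R[i]).
Implicit Types (f : V -> R[i]) (U : set V) (v x : V).

Definition re_line f x v (t : R) : R := complex.Re (f (x + t%:C *: v)).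
Definition im_line f x v (t : R) : R := complex.Im (f (x + t%:C *: v)).

Definition rderivable f x v : Prop :=
  derivable (re_line f x v) 0 1 /\ derivable (im_line f x v) 0 1.

Definition rderive v f x : R[i] :=
  derive1 (re_line f x v) 0 +i* derive1 (im_line f x v) 0.

Fixpoint Cn (k : nat) U f : Prop :=
  (forall x, U x -> {for x, continuous f}) /\
  (if k is k'.+1 then
     forall v, (forall x, U x -> rderivable f x v) /\ Cn k' U (rderive v f)
   else True).

Definition smooth U f : Prop := forall k, Cn k U f.

Definition wirtinger v f x : R[i] :=
  (rderive v f x - 'i * rderive ('i *: v) f x) / 2%:R.

Definition wirtinger_bar v f x : R[i] :=
  (rderive v f x + 'i * rderive ('i *: v) f x) / 2%:R.

End RealCalculus.

Definition partial (R : realType) (n : nat) (k : 'I_n)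
    (f : 'rV[R[i]]_n -> R[i]) (x : 'rV[R[i]]_n) : R[i] :=
  wirtinger (delta_mx 0 k) f x.

Definition partial_bar (R : realType) (n : nat) (k : 'I_n)
    (f : 'rV[R[i]]_n -> R[i]) (x : 'rV[R[i]]_n) : R[i] :=
  wirtinger_bar (delta_mx 0 k) f x.

(** * Complex manifolds *)

Record complex_manifold (R : realType) (n : nat) := ComplexManifold {
  mspace :> topologicalType;
  mspace_hausdorff : hausdorff_space mspace;
  mspace_second_countable : @second_countable mspace;
  chart : Type;
  dom : chart -> set mspace;
  img : chart -> set 'rV[R[i]]_n;
  coord : chart -> mspace -> 'rV[R[i]]_n;
  (* only meaningful on [img a] *)
  pt : chart -> 'rV[R[i]]_n -> mspace;
  dom_open : forall a, open (dom a);
  img_open : forall a, open (img a);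
  coord_img : forall a p, dom a p -> img a (coord a p);
  pt_dom : forall a z, img a z -> dom a (pt a z);
  coordK : forall a p, dom a p -> pt a (coord a p) = p;
  ptK : forall a z, img a z -> coord a (pt a z) = z;
  coord_continuous : forall a p, dom a p -> {for p, continuous (coord a)};
  pt_continuous : forall a z, img a z -> {for z, continuous (pt a)};
  chart_cover : forall p, exists a, dom a p;
  (* differentiability over the scalar field [R[i]], i.e. holomorphy *)
  transition_holomorphic : forall a b z, img a z -> dom b (pt a z) ->
    differentiable (coord b \o pt a) z
}.

Section Manifold.
Variables (R : realType) (n : nat) (M : complex_manifold R n).
Local Notation vec := 'rV[R[i]]_n.

Definition overlap (a b : chart M) : set vec :=
  [set z | img a z /\ dom b (pt a z)].

Definition transition (a b : chart M) : vec -> vec := coord b \o pt a.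

(* The coordinate change of [T'M] is
   (z, eta) |-> (transition a b z, dtransition a b z eta). *)
Definition dtransition (a b : chart M) (z eta : vec) : vec :=
  'd (transition a b) z eta.

(* Functions on T'M, given by their expressions in the induced coordinates
   (z, eta); only the values at [img a z] are meaningful. *)
Definition tangent_function (T : Type) := chart M -> vec -> vec -> T.

Definition well_defined (T : Type) (f : tangent_function T) : Prop :=
  forall a b z eta, overlap a b z ->
    f b (transition a b z) (dtransition a b z eta) = f a z eta.

Definition smooth_function (u : M -> R) : Prop :=
  forall a, smooth (img a) (fun z => (u (pt a z))%:C).

(* smoothness on T'M minus its zero section *)
Definition smooth_slit (f : tangent_function R[i]) : Prop :=
  forall a, smooth [set x : vec * vec | img a x.1 /\ x.2 != 0]
                   (fun x => f a x.1 x.2).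

Record vector_field := VectorField {
  vf :> chart M -> vec -> vec;
  vf_smooth : forall a i, smooth (img a) (fun z => vf a z 0 i);
  vf_transition : forall a b z, overlap a b z ->
    vf b (transition a b z) = dtransition a b z (vf a z)
}.

(* sum of h_{i \bar j} x^i \bar y^j *)
Definition sesquilinear (A : 'M[R[i]]_n) (x y : vec) : R[i] :=
  \sum_i \sum_j A i j * x 0 i * (y 0 j)^*.

Record hermitian_metric := HermitianMetric {
  hmx :> chart M -> vec -> 'M[R[i]]_n;
  hmx_smooth : forall a i j, smooth (img a) (fun z => hmx a z i j);
  hmx_hermitian : forall a z, img a z ->
    forall i j, hmx a z j i = (hmx a z i j)^*;
  hmx_posdef : forall a z, img a z ->
    forall x, x != 0 -> 0 < sesquilinear (hmx a z) x x;
  hmx_transition : forall a b z, overlap a b z -> forall x y,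
    sesquilinear (hmx b (transition a b z))
      (dtransition a b z x) (dtransition a b z y) =
    sesquilinear (hmx a z) x y
}.

Definition hnorm (h : hermitian_metric) : tangent_function R :=
  fun a z eta => Num.sqrt (complex.Re (sesquilinear (h a z) eta eta)).

End Manifold.

(** * Local invariants of a metric

    [F] is the expression of a metric in a chart of T'M. *)
Section Spray.
Variables (R : realType) (n : nat).
Local Notation vec := 'rV[R[i]]_n.
Variable F : vec -> vec -> R.
Implicit Types (z eta : vec) (i j k : 'I_n).

(* entry (i, j) is g_{i \bar j} *)
Definition fundamental z eta : 'M[R[i]]_n :=
  \matrix_(i, j)
    partial i (partial_bar j (fun xi => ((F z xi) ^+ 2)%:C)) eta.

(* entry (m, i) is g^{\bar m i}: g_{l \bar m} g^{\bar m i} = delta_l^i *)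
Definition fundamental_inv z eta : 'M[R[i]]_n := invmx (fundamental z eta).

Definition nonlinear_connection z eta i j : R[i] :=
  \sum_m \sum_l fundamental_inv z eta m i
    * partial j (fun w => fundamental w eta l m) z * eta 0 l.

Definition connection_coef z eta i j k : R[i] :=
  partial j (fun xi => nonlinear_connection z xi i k) eta.

Definition spray z eta i : R[i] :=
  2%:R^-1 * \sum_j nonlinear_connection z eta i j * eta 0 j.

Definition theta_star z eta i : R[i] :=
  \sum_m \sum_l \sum_p \sum_j
    fundamental_inv z eta m i * fundamental z eta l p
    * ((connection_coef z eta p j m)^* - (connection_coef z eta p m j)^*)
    * eta 0 l * (eta 0 j)^*.

End Spray.

(** * Projective and homothetic relations, conformal solutions *)
Section Navigation.
Variables (R : realType) (n : nat) (M : complex_manifold R n).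
Local Notation vec := 'rV[R[i]]_n.

Definition projectively_related (F F' : tangent_function M R) : Prop :=
  exists P : tangent_function M R[i],
    [/\ well_defined P, smooth_slit P &
      forall a z eta i, img a z -> eta != 0 ->
        spray (F' a) z eta i =
          spray (F a) z eta i
          + 2%:R^-1 * (theta_star (F' a) z eta i - theta_star (F a) z eta i)
          + P a z eta * eta 0 i].

Definition conformal (rho : M -> R) (F F' : tangent_function M R) : Prop :=
  forall a z eta, img a z -> F a z eta = rho (pt a z) * F' a z eta.

Definition homothetic (F F' : tangent_function M R) : Prop :=
  exists rho : M -> R, conformal rho F F' /\ exists c, forall p, rho p = c.

(* [speed] is the function ||u||_h *)
Record navigation_data := NavigationData {
  metric : hermitian_metric M;
  speed : M -> R;
  wind : vector_field M;
  speed_smooth : smooth_function speed;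
  wind_lt_speed : forall a z, img a z ->
    hnorm metric a z (wind a z) < speed (pt a z);
  speed_le1 : forall p, speed p <= 1
}.

Variant conformal_solution (D : navigation_data) (phi : R)
    (F : tangent_function M R) : Prop :=
| solution_without_wind of
    (forall a z, img a z -> wind D a z = 0) &
    (forall a z eta, img a z ->
       F a z eta = (speed D (pt a z))^-1 * hnorm (metric D) a z eta)
| solution_orthogonal_wind of
    (forall a z, img a z -> wind D a z != 0) &
    cos phi = 0 &
    (forall a z eta, img a z ->
       F a z eta =
         (Num.sqrt (speed D (pt a z) ^+ 2
                    - hnorm (metric D) a z (wind D a z) ^+ 2))^-1
         * hnorm (metric D) a z eta).

(* v = u + W, where u has the prescribed length and phi = arg h(v, \bar W) *)
Definition resultant_velocity (D : navigation_data) (phi : R)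
    (a : chart M) (z v : vec) : Prop :=
  hnorm (metric D) a z (v - wind D a z) = speed D (pt a z) /\
  sesquilinear (metric D a z) v (wind D a z) =
    `|sesquilinear (metric D a z) v (wind D a z)| * (cos phi +i* sin phi).

Lemma sesquilinearB (A : 'M[R[i]]_n) (x y : vec) :
  sesquilinear A (x - y) (x - y) =
  sesquilinear A x x - sesquilinear A x y - sesquilinear A y x
  + sesquilinear A y y.
Proof.
rewrite /sesquilinear -!sumrB -big_split /=; apply: eq_bigr => i _.
rewrite -!sumrB -big_split /=; apply: eq_bigr => j _.
rewrite !mxE rmorphB /=; ring.
Qed.

Lemma sesquilinear_conj (h : hermitian_metric M) a z (x y : vec) :
  img a z -> sesquilinear (h a z) y x = (sesquilinear (h a z) x y)^*.
Proof.
move=> az; rewrite /sesquilinear exchange_big rmorph_sum /=.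
apply: eq_bigr => i _; rewrite rmorph_sum /=; apply: eq_bigr => j _.
rewrite (hmx_hermitian h az i j) !rmorphM /= conjcK; ring.
Qed.

Lemma hnorm_sqr (h : hermitian_metric M) a z (x : vec) : img a z ->
  hnorm h a z x ^+ 2 = complex.Re (sesquilinear (h a z) x x).
Proof.
move=> az; rewrite sqr_sqrtr //; have [->|x0] := eqVneq x 0.
  by rewrite /sesquilinear big1 // => i _; rewrite big1 // => j _;
    rewrite !mxE mulr0 mul0r.
by have := hmx_posdef h az x0; rewrite ltcE /= => /andP[_ /ltW].
Qed.

(* The conformal solution solves the navigation problem: the resultant
   velocities have unit length. *)
Lemma conformal_solution_unit (D : navigation_data) (phi : R) F a z v :
  conformal_solution D phi F -> img a z ->
  resultant_velocity D phi a z v -> F a z v = 1.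
Proof.
move=> sol az [uv angle].
have speed0 : 0 < speed D (pt a z).
  by apply: le_lt_trans (wind_lt_speed D az); apply: sqrtr_ge0.
case: sol => [W0 ->//|_ cos0 ->//].
  by move: uv; rewrite (W0 _ _ az) subr0 => ->; rewrite mulVf // gt_eqF.
have ReW : complex.Re (sesquilinear (metric D a z) v (wind D a z)) = 0.
  by rewrite angle cos0 normc_def /=; ring.
have := congr1 (fun t => t ^+ 2) uv; rewrite /= (hnorm_sqr _ _ az).
rewrite sesquilinearB (sesquilinear_conj (metric D) v (wind D a z) az).
set b := sesquilinear _ v (wind D a z) in ReW *.
have -> : complex.Re (sesquilinear (metric D a z) v v - b - b^*
    + sesquilinear (metric D a z) (wind D a z) (wind D a z)) =
  hnorm (metric D) a z v ^+ 2 + hnorm (metric D) a z (wind D a z) ^+ 2.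
  rewrite !hnorm_sqr //; move: ReW; case: b {angle} => br bi /= ->.
  by case: sesquilinear => ? ?; case: sesquilinear => ? ? /=; ring.
move=> e; rewrite -e addrK sqrtr_sqr ger0_norm ?sqrtr_ge0 // mulVf //.
rewrite -sqrf_eq0; apply/eqP => v0; move: e; rewrite v0 add0r => /eqP.
rewrite eqrXn2 ?sqrtr_ge0 ?ltW // => /eqP eW.
by have := wind_lt_speed D az; rewrite eW ltxx.
Qed.

End Navigation.

(* Main.v *)
(** In every chart both cases of the conformal solution read
    [F ^+ 2 = s * hnorm ^+ 2] with [s = (speed ^+ 2 - |W| ^+ 2)^-1]. Put
    [d = partial s / s], [Q = h(eta, eta)] and [d# = h^-1 (conj d)]. The spray
    of [F] is that of [h] plus [1/2 d(eta) eta], and [theta_star] of [F] is that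
    of [h] plus [Q d# - conj (d(eta)) eta]. Hence the metrics are projectively
    related only if [Q d#] is proportional to [eta] for every [eta <> 0]; the
    [i]-th component for [eta = e_j] with [j <> i] gives [d# = 0], so [s] has
    vanishing differential and is constant on the connected manifold. *)

Require Import Defs.
From mathcomp Require Import all_boot all_order all_algebra.
From mathcomp Require Import all_classical all_reals all_analysis.
From mathcomp Require Import complex ring.

Set Implicit Arguments.
Unset Strict Implicit.
Unset Printing Implicit Defensive.

Import Order.TTheory GRing.Theory Num.Theory.
Import numFieldNormedType.Exports.

Local Open Scope classical_set_scope.
Local Open Scope ring_scope.
Local Open Scope complex_scope.

(** * Calculus of derivatives along real lines *)

Lemma is_derive_quadratic (R : realType) (a b c : R) :
  is_derive (0 : R) 1 (fun t => a + t * b + t ^+ 2 * c) b.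
Proof.
have fE : (fun t : R => a + t * b + t ^+ 2 * c) =
    cst a + (id * cst b + (id * id) * cst c) by apply/funext => t /=; rewrite !fctE; ring.
rewrite fE; have D := is_derive_id (0 : R) 1.
have C k := is_derive_cst (k : R) (0 : R) (1 : R).
have B := is_deriveM D (C b).
have A := is_deriveD (C a) (is_deriveD B (is_deriveM (is_deriveM D D) (C c))).
apply: is_derive_eq A _; rewrite /GRing.scale /= !fctE; ring.
Qed.

Section RealDerivatives.
Variables (R : realType) (V : normedModType R[i]).
Implicit Types (f g : V -> R[i]) (x v : V) (c d : R[i]).

(** [rderive] has a value even where no derivative exists; this predicate carries existence and
    value together, so that the rules below compose. *)
Definition is_rderive x v f d : Prop :=
  is_derive (0 : R) 1 (re_line f x v) (complex.Re d) /\
  is_derive (0 : R) 1 (im_line f x v) (complex.Im d).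

Lemma is_rderiveP f x v : rderivable f x v -> is_rderive x v f (rderive v f x).
Proof.
rewrite /rderivable => -[fr fi]; split; rewrite /rderive.
  by rewrite [complex.Re _]derive1E; exact: DeriveDef fr erefl.
by rewrite [complex.Im _]derive1E; exact: DeriveDef fi erefl.
Qed.

Lemma is_rderive_derivable f x v d : is_rderive x v f d -> rderivable f x v.
Proof. rewrite /is_rderive /rderivable => -[fr fi].
split; [exact: (@ex_derive _ _ _ _ _ _ _ fr)|exact: (@ex_derive _ _ _ _ _ _ _ fi)].
 Qed.

Lemma rderive_val f x v d : is_rderive x v f d -> rderive v f x = d.
Proof.
move=> [[_ er] [_ ei]]; rewrite /rderive !derive1E er ei; by case: d {er ei}.
Qed.

Lemma is_rderiveD f g x v c d : is_rderive x v f c -> is_rderive x v g d ->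
  is_rderive x v (fun y => f y + g y) (c + d).
Proof.
move=> [fr fi] [gr gi]; split.
  rewrite raddfD; rewrite (_ : re_line _ _ _ = re_line f x v \+ re_line g x v).
    exact: is_deriveD.
  by apply/funext => t; rewrite /re_line raddfD.
rewrite raddfD; rewrite (_ : im_line _ _ _ = im_line f x v \+ im_line g x v).
  exact: is_deriveD.
by apply/funext => t; rewrite /im_line raddfD.
Qed.

Lemma ReM (c d : R[i]) : complex.Re (c * d) =
  complex.Re c * complex.Re d - complex.Im c * complex.Im d.
Proof. by case: c d => [? ?] [? ?]. Qed.

Lemma ImM (c d : R[i]) : complex.Im (c * d) =
  complex.Re c * complex.Im d + complex.Im c * complex.Re d.
Proof. by case: c d => [? ?] [? ?]. Qed.

Lemma is_rderiveM f g x v c d : is_rderive x v f c -> is_rderive x v g d ->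
  is_rderive x v (fun y => f y * g y) (c * g x + f x * d).
Proof.
move=> [fr fi] [gr gi]; split.
  rewrite (_ : re_line _ _ _ =
      re_line f x v * re_line g x v - im_line f x v * im_line g x v).
    apply: (is_derive_eq (is_deriveB (is_deriveM fr gr) (is_deriveM fi gi))).
    rewrite !raddfD /= !ReM /re_line /im_line.
    rewrite scale0r addr0 /GRing.scale /=; ring.
  by apply/funext => t; rewrite /re_line ReM.
rewrite (_ : im_line _ _ _ =
    re_line f x v * im_line g x v + im_line f x v * re_line g x v).
  apply: (is_derive_eq (is_deriveD (is_deriveM fr gi) (is_deriveM fi gr))).
  rewrite !raddfD /= !ImM /re_line /im_line.
  rewrite scale0r addr0 /GRing.scale /=; ring.
by apply/funext => t; rewrite /im_line ImM.
Qed.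

Lemma is_rderive_cst c x v : is_rderive x v (fun=> c) 0.
Proof. by split; apply: is_derive_cst. Qed.

Lemma is_rderiveN f x v c : is_rderive x v f c ->
  is_rderive x v (fun y => - f y) (- c).
Proof.
move=> [fr fi]; split.
  rewrite raddfN (_ : re_line _ _ _ = - re_line f x v).
    exact: is_deriveN.
  by apply/funext => t; rewrite /re_line raddfN.
rewrite raddfN (_ : im_line _ _ _ = - im_line f x v).
  exact: is_deriveN.
by apply/funext => t; rewrite /im_line raddfN.
Qed.

Lemma is_rderive_conj f x v c : is_rderive x v f c ->
  is_rderive x v (fun y => (f y)^*%R) c^*%R.
Proof.
move=> [fr fi]; split.
  rewrite (_ : re_line _ _ _ = re_line f x v).
    by case: c fr {fi}.
  by apply/funext => t; rewrite /re_line; case: (f _).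
rewrite (_ : im_line _ _ _ = - im_line f x v).
  rewrite (_ : complex.Im _ = - complex.Im c); first exact: is_deriveN.
  by case: c {fr fi}.
by apply/funext => t; rewrite /im_line fctE; case: (f _).
Qed.

Lemma is_rderive_Re f x v c : is_rderive x v f c ->
  is_rderive x v (fun y => (complex.Re (f y))%:C) (complex.Re c)%:C.
Proof. by move=> [fr _]; split=> //; exact: is_derive_cst. Qed.

Lemma is_rderive_sum (I : Type) (r : seq I) (P : pred I)
    (f : I -> V -> R[i]) (d : I -> R[i]) x v :
  (forall i, P i -> is_rderive x v (f i) (d i)) ->
  is_rderive x v (fun y => \sum_(i <- r | P i) f i y) (\sum_(i <- r | P i) d i).
Proof.
move=> fd; elim: r => [|i r IH].
  by rewrite big_nil; under eq_fun do rewrite big_nil; apply: is_rderive_cst.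
rewrite big_cons; under eq_fun do rewrite big_cons.
by case: ifP => // Pi; apply: is_rderiveD => //; apply: fd.
Qed.

Lemma is_rderive_real_inv (f : V -> R) x v c : f x != 0 ->
  is_rderive x v (fun y => (f y)%:C) c ->
  rderivable (fun y => ((f y)^-1)%:C) x v.
Proof.
move=> fx0 [[fr _] _]; split.
  apply: (@derivableV _ _ (re_line (fun y => (f y)%:C) x v)) => //=.
  by rewrite /re_line scale0r addr0.
exact: derivable_cst.
Qed.

(** Hermitian forms and linear functions restrict to polynomials of degree at most two on real
    lines, so their derivatives can be read off as linear coefficients. *)
Lemma is_rderive_quadratic f x v c1 c2 :
  (forall t : R, f (x + t%:C *: v) = f x + t%:C * c1 + (t ^+ 2)%:C * c2) ->
  is_rderive x v f c1.
Proof.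
move=> fE; split.
    have -> : re_line f x v = fun t => complex.Re (f x) + t * complex.Re c1
      + t ^+ 2 * complex.Re c2.
    by apply/funext => t; rewrite /re_line fE !raddfD /= !ReM /= !mul0r !subr0.
  exact: is_derive_quadratic.
have -> : im_line f x v = fun t => complex.Im (f x) + t * complex.Im c1
    + t ^+ 2 * complex.Im c2.
  by apply/funext => t; rewrite /im_line fE !raddfD /= !ImM /= !mul0r !addr0.
exact: is_derive_quadratic.
Qed.

Lemma near_line (U : set V) x v : open U -> U x ->
  \forall t \near (0 : R), U (x + t%:C *: v).
Proof.
move=> Uo Ux; have /nbhs_ballP[e /= e0 eU] : nbhs x U by exact: open_nbhs_nbhs.
(* Radii and norms live in [R[i]]; nonnegativity there forces the imaginary part to vanish, so the
   estimate can be made in [R]. *)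
have eE : e = (complex.Re e)%:C.
  by move: e0; case: (e) => ? ?; rewrite ltcE /= => /andP[/eqP ->].
have re0 : 0 < complex.Re e by move: e0; rewrite ltcE => /andP[].
have vE : `|v| = (complex.Re `|v|)%:C.
  by have := normr_ge0 v; case: (`|v|) => ? ?; rewrite lecE /= => /andP[/eqP ->].
have rv0 : 0 <= complex.Re `|v| by have := normr_ge0 v; rewrite lecE => /andP[].
(* The [+ 1] keeps the denominator positive when [v = 0]. *)
pose d := complex.Re e / (complex.Re `|v| + 1).
have d0 : 0 < d by rewrite divr_gt0 // ltr_wpDl.
apply/nbhs_ballP; exists d => //= t; rewrite /ball /= sub0r normrN => td.
apply: eU; rewrite -ball_normE /= opprD addNKr normrN normrZ normc_def /=.
rewrite expr0n /= addr0 sqrtr_sqr eE vE -rmorphM ltcR.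
move: td; rewrite /d ltr_pdivlMr; last by rewrite ltr_wpDl.
by apply: le_lt_trans; rewrite ler_wpM2l // lerDl.
Qed.

(** A derivative depends on the germ only. Chart expressions are meaningful only on an open set, and
    this lets identities valid there be differentiated. *)
Lemma near_rderive (U : set V) f g x v : open U -> U x ->
  (forall y, U y -> f y = g y) -> rderive v f x = rderive v g x.
Proof.
move=> Uo Ux fg; rewrite /rderive !derive1E; congr (_ +i* _); apply: near_eq_derive;
   near=> t; rewrite /re_line /im_line fg //; near: t; exact: near_line.
Unshelve. all: by end_near. Qed.

Lemma near_wirtinger (U : set V) f g x v : open U -> U x ->
  (forall y, U y -> f y = g y) -> wirtinger v f x = wirtinger v g x.
Proof. by move=> Uo Ux fg; rewrite /wirtinger !(near_rderive _ Uo Ux fg). Qed.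

Lemma smooth_rderivable (U : set V) f x v : smooth U f -> U x -> rderivable f x v.
Proof. by move=> fs Ux; have [_ /(_ v)[+ _]] := fs 1; apply. Qed.

Lemma wirtingerM f g x v : (forall w, rderivable f x w) ->
  (forall w, rderivable g x w) -> wirtinger v (fun y => f y * g y) x =
    wirtinger v f x * g x + f x * wirtinger v g x.
Proof.
move=> fd gd; rewrite /wirtinger.
rewrite !(rderive_val (is_rderiveM (is_rderiveP (fd _)) (is_rderiveP (gd _)))).
by ring.
Qed.

(** Supplies the smoothness of the factor [P = 0] used for homothetic metrics. *)
Lemma smooth_cst0 (U : set V) : smooth U (fun=> 0 : R[i]).
Proof.
elim=> [|k IH]; (split; first by move=> x _; exact: cst_continuous).
  exact: I.
move=> v; split=> [x _|].
  exact: is_rderive_derivable (is_rderive_cst 0 x v).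
rewrite (_ : rderive v _ = fun=> 0) //; apply/funext => x.
exact: rderive_val (is_rderive_cst 0 x v).
Qed.

End RealDerivatives.

(** * Hermitian forms and their Wirtinger derivatives *)

Section HermitianForm.
Variables (R : realType) (n : nat).
Local Notation vec := 'rV[R[i]]_n.
Implicit Types (A B : 'M[R[i]]_n) (x y v : vec).

Lemma sesquilinear_mulmx A x y :
  sesquilinear A x y = \sum_j (x *m A) 0 j * (y 0 j)^*.
Proof.
rewrite /sesquilinear exchange_big; apply: eq_bigr => j _ /=.
by rewrite mxE mulr_suml; apply: eq_bigr => i _; rewrite [A i j * _]mulrC.
Qed.

Lemma sesquilinear_delta A x j : sesquilinear A x (delta_mx 0 j) = (x *m A) 0 j.
Proof.
rewrite sesquilinear_mulmx (bigD1 j) //= big1 ?addr0 => [|k kj].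
  by rewrite [delta_mx _ _ _ _]mxE !eqxx rmorph1 mulr1.
by rewrite [delta_mx _ _ _ _]mxE eqxx (negPf kj) rmorph0 mulr0.
Qed.

(** A row vector killed by [A] gives the form the value [0], so the kernel is trivial. *)
Lemma posdef_unitmx A :
  (forall x, x != 0 -> 0 < sesquilinear A x x) -> A \in unitmx.
Proof.
move=> Apos; rewrite -row_free_unit -kermx_eq0; apply/negPn/negP.
move=> /rowV0Pn[x /sub_kermxP xA x0]; have := Apos _ x0.
by rewrite sesquilinear_mulmx xA big1 ?ltxx // => j _; rewrite mxE mul0r.
Qed.

Lemma is_rderive_sesquilinear A x v :
  is_rderive x v (fun y => sesquilinear A y y)
    (sesquilinear A v x + sesquilinear A x v).
Proof.
apply: (@is_rderive_quadratic _ _ _ _ _ _ (sesquilinear A v v)) => t.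
rewrite /sesquilinear -big_split /= !mulr_sumr -!big_split /=.
apply: eq_bigr => i _; rewrite -big_split /= !mulr_sumr -!big_split /=.
apply: eq_bigr => j _; rewrite !mxE.
have -> : (t ^+ 2)%:C = t%:C * t%:C :> R[i] by rewrite expr2 rmorphM.
(* Of the real scalar only its invariance under conjugation is kept; what remains is a polynomial
   identity. *)
have : (t%:C)^*%R = t%:C :> R[i] by apply/eqP; rewrite eq_complex /= oppr0 !eqxx.
move: (t%:C) => T TJ; rewrite rmorphD rmorphM /= TJ; ring.
Qed.

Lemma sesquilinear_il A x y :
  sesquilinear A ('i *: x) y = 'i * sesquilinear A x y.
Proof.
rewrite mulr_sumr; apply: eq_bigr => i _; rewrite mulr_sumr.
by apply: eq_bigr => j _; rewrite mxE; ring.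
Qed.

Lemma sesquilinear_ir A x y :
  sesquilinear A x ('i *: y) = - 'i * sesquilinear A x y.
Proof.
rewrite mulr_sumr; apply: eq_bigr => i _; rewrite mulr_sumr.
apply: eq_bigr => j _; rewrite mxE rmorphM /=.
rewrite conjCi; ring.
Qed.

(** In [D_v + i D_{iv}] the part linear in the direction, h(v, x), cancels, and the conjugate-linear
    part, h(x, v), doubles. *)
Lemma partial_bar_sesquilinear A x j :
  partial_bar j (fun y => sesquilinear A y y) x = \sum_i A i j * x 0 i.
Proof.
rewrite /partial_bar /wirtinger_bar !(rderive_val (is_rderive_sesquilinear _ _ _)).
rewrite sesquilinear_il sesquilinear_ir mulrDr !mulrA mulrN.
rewrite (_ : 'i * 'i = -1 :> R[i]); last by rewrite -expr2 sqrCi.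
rewrite sesquilinear_delta mxE (_ : (_ + _) / _ = \sum_i x 0 i * A i j).
  by apply: eq_bigr => i _; rewrite mulrC.
by field.
Qed.

Lemma partial_linear (c : 'I_n -> R[i]) j x :
  partial j (fun y : vec => \sum_l c l * y 0 l) x = c j.
Proof.
have D v : is_rderive x v (fun y : vec => \sum_l c l * y 0 l) (\sum_l c l * v 0 l).
  apply: (@is_rderive_quadratic _ _ _ _ _ _ 0) => t; rewrite mulr0 addr0.
  by rewrite mulr_sumr -big_split; apply: eq_bigr => l _ /=; rewrite !mxE; ring.
rewrite /partial /wirtinger !(rderive_val (D _)).
(* Used at the scalars [1] and ['i], the two directions in a Wirtinger derivative. *)
have S k : \sum_l c l * (k *: delta_mx 0 j : vec) 0 l = k * c j.
  rewrite (bigD1 j) //= big1 ?addr0 => [|l lj]; rewrite !mxE ?eqxx ?mulr1 1?mulrC //.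
  by rewrite (negPf lj) !mulr0 mul0r.
have := S 1; rewrite scale1r mul1r => ->; rewrite S mulrA -expr2 sqrCi.
by field.
Qed.

End HermitianForm.

(** * Spray and torsion of a metric whose square is a Hermitian form *)

Section QuadraticSpray.
Variables (R : realType) (n : nat).
Local Notation vec := 'rV[R[i]]_n.
Variables (F : vec -> vec -> R) (A : vec -> 'M[R[i]]_n) (U : set vec).
Hypothesis U_open : open U.
Hypothesis FA : forall z, U z -> forall x,
  ((F z x) ^+ 2)%:C = sesquilinear (A z) x x.

(* [k] is the direction of differentiation: this is [L^i_{lk}] of the metric. *)
Definition chern (A : vec -> 'M[R[i]]_n) (z : vec) (i k l : 'I_n) : R[i] :=
  \sum_m invmx (A z) m i * partial k (fun w => A w l m) z.

(** The antiholomorphic derivative of the form is linear in the fibre variable, and the holomorphic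
    derivative then reads off its coefficient. *)
Lemma fundamental_quadratic z x : U z -> fundamental F z x = A z.
Proof.
move=> Uz; apply/matrixP => i j; rewrite mxE.
rewrite (_ : (fun xi => _) = fun y => sesquilinear (A z) y y); last first.
  by apply/funext => y; rewrite FA.
rewrite (_ : partial_bar _ _ = fun y : vec => \sum_l A z l j * y 0 l).
  by rewrite partial_linear.
by apply/funext => y; rewrite partial_bar_sesquilinear.
Qed.

Lemma nonlinear_connection_quadratic z x i k : U z ->
  nonlinear_connection F z x i k = \sum_l chern A z i k l * x 0 l.
Proof.
move=> Uz; rewrite /nonlinear_connection exchange_big; apply: eq_bigr => l _ /=.
rewrite mulr_suml; apply: eq_bigr => m _.
rewrite /fundamental_inv fundamental_quadratic // /partial.
(* [fundamental] is known to equal [A] on [U] only; since [U] is open, the derivative in the base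
   passes to [A]. *)
rewrite (near_wirtinger _ U_open Uz (g := fun w => A w l m)) // => w Uw.
by rewrite fundamental_quadratic.
Qed.

(** The connection is linear in the fibre variable, so differentiation returns its coefficient. The
    lower indices are exchanged because [chern] lists the direction of differentiation first. *)
Lemma connection_coef_quadratic z x i j k : U z ->
  connection_coef F z x i j k = chern A z i k j.
Proof.
move=> Uz; rewrite /connection_coef.
rewrite (_ : (fun xi => _) = fun y : vec => \sum_l chern A z i k l * y 0 l).
  by rewrite partial_linear.
by apply/funext => y; rewrite nonlinear_connection_quadratic.
Qed.

Lemma spray_quadratic z x i : U z ->
  spray F z x i =
    2%:R^-1 * \sum_k (\sum_l chern A z i k l * x 0 l) * x 0 k.
Proof.
move=> Uz; rewrite /spray; congr (_ * _); apply: eq_bigr => k _.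
by rewrite nonlinear_connection_quadratic.
Qed.

Lemma theta_star_quadratic z x i : U z ->
  theta_star F z x i = \sum_m \sum_l \sum_p \sum_j
    invmx (A z) m i * A z l p * ((chern A z p m j)^* - (chern A z p j m)^*)
    * x 0 l * (x 0 j)^*.
Proof.
move=> Uz; rewrite /theta_star; apply: eq_bigr => m _; apply: eq_bigr => l _.
apply: eq_bigr => p _; apply: eq_bigr => j _.
by rewrite /fundamental_inv !fundamental_quadratic // !connection_coef_quadratic.
Qed.

End QuadraticSpray.

(** * Conformal change of the metric *)

Lemma conformal_term (K : fieldType) (s a b c1 c2 d1 d2 e1 e2 x y : K) : s != 0 ->
  s^-1 * a * (s * b) * (c1 + d1 * e1 - (c2 + d2 * e2)) * x * y =
  a * b * (c1 - c2) * x * y + a * b * (d1 * e1) * x * y - a * b * (d2 * e2) * x * y.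
Proof. by move=> s0; field. Qed.

Section ConformalChange.
Variables (R : realType) (n : nat).
Local Notation vec := 'rV[R[i]]_n.
Variables (F F' : vec -> vec -> R) (A : vec -> 'M[R[i]]_n) (U : set vec).
Variables (s : vec -> R) (z : vec).
Hypothesis U_open : open U.
Hypothesis Uz : U z.
Hypothesis FA : forall w, U w -> forall x,
  ((F w x) ^+ 2)%:C = sesquilinear (A w) x x.
Hypothesis F'F : forall w, U w -> forall x, (F' w x) ^+ 2 = s w * F w x ^+ 2.
Hypothesis A_unit : A z \in unitmx.
Hypothesis A_derivable : forall l m v, rderivable (fun w => A w l m) z v.
Hypothesis s_derivable : forall v, rderivable (fun w => (s w)%:C) z v.
Hypothesis s_neq0 : s z != 0.

Let d k : R[i] := partial k (fun w => (s w)%:C) z / (s z)%:C.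
Let sA w := (s w)%:C *: A w.

Lemma conformal_quadratic w : U w -> forall x,
  ((F' w x) ^+ 2)%:C = sesquilinear (sA w) x x.
Proof.
move=> Uw x; rewrite F'F // rmorphM /= FA // mulr_sumr; apply: eq_bigr => i _.
rewrite mulr_sumr; apply: eq_bigr => j _; rewrite mxE; ring.
Qed.

Lemma invmx_sum l i : \sum_m invmx (A z) m i * A z l m = (l == i)%:R.
Proof.
have := mulmxV A_unit => /matrixP/(_ l i); rewrite !mxE => <-.
by apply: eq_bigr => m _; rewrite mulrC.
Qed.

Lemma sC_neq0 : (s z)%:C != 0 :> R[i].
Proof. by rewrite eq_complex /= eqxx andbT. Qed.

Lemma invmx_conformal m i : invmx (sA z) m i = ((s z)%:C)^-1 * invmx (A z) m i.
Proof. by rewrite invmxZ ?unitmxZ ?unitfE ?sC_neq0 // mxE. Qed.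

(** Product rule: when the derivative falls on [A], the factor [s] cancels; when it falls on [s],
    the inverse matrix meets [A] and leaves the Kronecker symbol. *)
Lemma chern_conformal i k l :
  chern sA z i k l = chern A z i k l + d k * (l == i)%:R.
Proof.
rewrite -invmx_sum mulr_sumr -big_split; apply: eq_bigr => m _ /=.
rewrite invmx_conformal /partial.
rewrite (_ : (fun w => sA w l m) = fun w => (s w)%:C * A w l m); last first.
  by apply/funext => w; rewrite mxE.
rewrite wirtingerM // /d /partial.
by field; exact: sC_neq0.
Qed.

Lemma chern_conformal_conj i k l :
  (chern sA z i k l)^*%R = (chern A z i k l)^*%R + (d k)^*%R * (l == i)%:R.
Proof. by rewrite chern_conformal rmorphD rmorphM rmorph_nat. Qed.

(** The Kronecker term of [chern_conformal] contracts the sum over [l] to its term at [i], leaving a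
    multiple of [x]. *)
Lemma spray_conformal x i :
  spray F' z x i = spray F z x i + 2%:R^-1 * (\sum_k d k * x 0 k) * x 0 i.
Proof.
rewrite (spray_quadratic U_open conformal_quadratic) // (spray_quadratic U_open FA) //.
rewrite -mulrA -mulrDr mulr_suml -big_split; congr (_ * _).
apply: eq_bigr => k _ /=; rewrite -[d k * _ * _]mulrAC -mulrDl; congr (_ * _).
under eq_bigr do rewrite chern_conformal mulrDl.
rewrite big_split /=; congr (_ + _).
rewrite (bigD1 i) //= eqxx mulr1 big1 ?addr0 // => l /negPf ->.
by rewrite mulr0 mul0r.
Qed.

(** The torsion acquires two Kronecker terms. One identifies [j] with [p] and completes the form
    h(x, x); the other identifies [m] with [p], so that the inverse matrix cancels [A] and leaves
    [x 0 i]. *)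
Lemma theta_star_conformal x i :
  theta_star F' z x i = theta_star F z x i
    + (\sum_m invmx (A z) m i * (d m)^*) * sesquilinear (A z) x x
    - (\sum_j (d j)^* * (x 0 j)^*) * x 0 i.
Proof.
rewrite (theta_star_quadratic U_open conformal_quadratic) //.
rewrite (theta_star_quadratic U_open FA) //.
have -> : (\sum_m invmx (A z) m i * (d m)^*) * sesquilinear (A z) x x =
  \sum_m \sum_l \sum_p \sum_j
    invmx (A z) m i * A z l p * ((d m)^* * (j == p)%:R) * x 0 l * (x 0 j)^*.
  rewrite mulr_suml; apply: eq_bigr => m _; rewrite mulr_sumr.
  apply: eq_bigr => l _; rewrite mulr_sumr; apply: eq_bigr => p _.
  rewrite (bigD1 p) //= big1 ?addr0 => [|j /negPf ->].
    by rewrite eqxx mulr1; ring.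
  by rewrite !mulr0 !mul0r.
have -> : (\sum_j (d j)^* * (x 0 j)^*) * x 0 i =
  \sum_m \sum_l \sum_p \sum_j
    invmx (A z) m i * A z l p * ((d j)^* * (m == p)%:R) * x 0 l * (x 0 j)^*.
  (* The component [x 0 i] is spread over a sum against a Kronecker symbol, which [invmx_sum] then
     expands to create the index [m]. *)
  transitivity (\sum_l (l == i)%:R * ((\sum_j (d j)^* * (x 0 j)^*) * x 0 l)).
    rewrite [RHS](bigD1 i) //= eqxx mul1r [X in _ = _ + X]big1 ?addr0 // => l.
    by move=> /negPf ->; rewrite mul0r.
  rewrite exchange_big; apply: eq_bigr => l _ /=.
  rewrite -invmx_sum mulr_suml; apply: eq_bigr => m _.
  rewrite [RHS](bigD1 m) //= [X in _ = _ + X]big1 ?addr0 => [|p /negPf pm].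
    rewrite eqxx mulr_suml mulr_sumr; apply: eq_bigr => j _.
    by rewrite mulr1; ring.
  by rewrite big1 // => j _; rewrite eq_sym pm !mulr0 !mul0r.
rewrite -big_split -sumrB; apply: eq_bigr => m _ /=.
rewrite -big_split -sumrB; apply: eq_bigr => l _ /=.
rewrite -big_split -sumrB; apply: eq_bigr => p _ /=.
rewrite -big_split -sumrB; apply: eq_bigr => j _ /=.
rewrite (invmx_conformal m i) (chern_conformal_conj p m j).
rewrite (chern_conformal_conj p j m) [sA z l p]mxE.
(* In each summand the factor [s] of the metric cancels the one of its inverse. *)
exact: conformal_term sC_neq0.
Qed.

End ConformalChange.

(** * From vanishing derivatives to constancy *)

Lemma locally_constant_connected (T : topologicalType) (X : Type) (f : T -> X) :
  connected [set: T] -> (forall p, \forall q \near p, f q = f p) ->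
  forall p q, f p = f q.
Proof.
(* All preimages are open; applied to the level set of [f p] and to its complement, this makes a
   nonempty clopen set. *)
move=> Tc fl p q; have Bo (Q : set X) : open (f @^-1` Q).
  by rewrite openE => r /= Qr; near=> t; rewrite /= (near (fl r) t).
suff : [set r | f p = f r] = [set: T] by move/seteqP => [_ /(_ q I)].
apply: Tc; first by exists p.
- by exists [set r | f p = f r]; [exact: (Bo [set y | f p = y])|rewrite setTI].
exists [set r | f p = f r]; last by rewrite setTI.
rewrite -[X in closed X]setCK; apply: open_closedC.
exact: (Bo (~` [set y | f p = y])).
Unshelve. all: by end_near. Qed.

Section LocallyConstant.
Variables (R : realType).

(** [is_rderive] concerns the parameter [0] only; translating the parameter moves the base point
    along the line. *)
Lemma re_line_is_derive (V : normedModType R[i]) (f : V -> R[i]) x v t d :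
  is_rderive (x + t%:C *: v) v f d ->
  is_derive t 1 (re_line f x v) (complex.Re d).
Proof.
move=> [fr _]; have -> : re_line f x v = re_line f (x + t%:C *: v) v \o shift (- t).
  apply/funext => u; rewrite /re_line /= rmorphB /= -addrA -scalerDl.
  by rewrite [t%:C + _]addrC subrK.
rewrite -[complex.Re d]mulr1; apply: is_derive1_comp; first by rewrite /shift /= subrr.
exact: is_derive_shift.
Qed.

Lemma eq_on_segment (V : normedModType R[i]) (f : V -> R) x v (r : R) :
  (forall t, `|t| <= `|r| ->
    is_rderive (x + t%:C *: v) v (fun y => (f y)%:C) 0) ->
  f (x + r%:C *: v) = f x.
Proof.
(* The mean value theorem wants ordered endpoints; this form serves both signs of [r]. *)
move=> fd; have line (a b : R) : a <= b ->
    (forall t, t \in `[a, b] -> `|t| <= `|r|) ->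
    f (x + b%:C *: v) = f (x + a%:C *: v).
  move=> ab abr; have D t : t \in `[a, b] ->
      is_derive t 1 (re_line (fun y => (f y)%:C) x v) 0.
    by move=> /abr /fd /re_line_is_derive.
  have [g gE] : exists g : R -> R, g = re_line (fun y => (f y)%:C) x v by eexists.
  rewrite -gE in D.
  have Doo t : t \in `]a, b[ -> is_derive t 1 g (cst 0 t).
    by move=> tab; apply: D; exact: subset_itv_oo_cc tab.
  have gc : {within `[a, b], continuous g}.
    by apply: derivable_within_continuous => t /D dt; exact: ex_derive.
  have [c _] := MVT_segment ab Doo gc.
  by rewrite /= mul0r => /eqP; rewrite subr_eq0 gE => /eqP.
rewrite -[in RHS](addr0 x) -(scale0r v); have [r0|/ltW r0] := leP 0 r.
  apply: (line 0 r r0) => t; rewrite in_itv /= => /andP[t0 tr].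
  by rewrite !ger0_norm.
apply/esym; apply: (line r 0 r0) => t; rewrite in_itv /= => /andP[tr t0].
by rewrite !ler0_norm // lerN2.
Qed.

(** For a real function the Wirtinger derivative is (a - i b) / 2 with [a] and [b] real, so both
    vanish together with it. *)
Lemma real_wirtinger_eq0 (V : normedModType R[i]) (f : V -> R) x v :
  (forall w, rderivable (fun y => (f y)%:C) x w) ->
  wirtinger v (fun y => (f y)%:C) x = 0 ->
  is_rderive x v (fun y => (f y)%:C) 0 /\
  is_rderive x ('i *: v) (fun y => (f y)%:C) 0.
Proof.
move=> fd; have ImD w : complex.Im (rderive w (fun y => (f y)%:C) x) = 0.
  by rewrite /= derive1_cst.
move/eqP; rewrite mulf_eq0 invr_eq0 pnatr_eq0 orbF.
have := is_rderiveP (fd v); have := is_rderiveP (fd ('i *: v)).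
have := ImD v; have := ImD ('i *: v).
case: (rderive v _ x) => a ?; case: (rderive _ _ x) => b ? /= -> -> Db Da.
rewrite eq_complex !raddfB /= !(mul0r, mul1r, subr0, sub0r, oppr0, addr0, add0r).
by move=> /andP[/eqP a0]; rewrite oppr_eq0 => /eqP b0; move: Da Db; rewrite a0 b0.
Qed.

Variable n : nat.
Local Notation vec := 'rV[R[i]]_n.

Lemma eq_on_polydisc (f : vec -> R) (x : vec) (e : R[i]) :
  (forall y, ball x e y -> forall k,
    is_rderive y (delta_mx 0 k) (fun y => (f y)%:C) 0 /\
    is_rderive y ('i *: delta_mx 0 k) (fun y => (f y)%:C) 0) ->
  forall y, ball x e y -> f y = f x.
Proof.
move=> fd y xey.
(* Move one coordinate at a time, first its real and then its imaginary part:
   this never leaves the sup-norm ball. *)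
suff /(_ n y xey) : forall m y, ball x e y ->
    (forall k : 'I_n, (m <= k)%N -> y 0 k = x 0 k) -> f y = f x.
  by apply => k; rewrite leqNgt ltn_ord.
elim=> [|m IH] {xey}y xey yx.
  by congr (f _); apply/rowP => k; apply: yx.
(* Past the last coordinate the agreement condition of the induction hypothesis is vacuous. *)
have [nm|mn] := leqP n m.
  by apply: IH => // k; rewrite leqNgt (leq_trans (ltn_ord k)).
(* [y0] is [y] with coordinate [m] reset to that of [x]; the increment back to [y] is [c], with real
   part [a] and imaginary part [b]. *)
pose k0 := Ordinal mn; pose y0 : vec := \row_k (if k == k0 then x 0 k else y 0 k).
pose c := y 0 k0 - x 0 k0; pose a := complex.Re c; pose b := complex.Im c.
(* Only coordinate [k0] moves; its distance from [x] is |s + i t|, at most |c|, which is below the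
   radius because [y] lies in the ball. *)
have near_y0 (s t : R) : `|s| <= `|a| -> `|t| <= `|b| ->
    ball x e (y0 + s%:C *: delta_mx 0 k0 + t%:C *: ('i *: delta_mx 0 k0)).
  move=> sa tb; case: xey => e0 xy; split=> // i k; rewrite (ord1 i) !mxE eqxx /=.
  have := xy 0 k; have [->|_] := eqVneq k k0; last by rewrite !mulr0 !addr0.
  rewrite !mulr1 -!ball_normE /= distrC -/c -addrA opprD addNKr normrN.
  apply: le_lt_trans; rewrite !normc_def lecR -/a -/b.
  rewrite ler_sqrt ?addr_ge0 ?sqr_ge0 //; move: a b sa tb => a b sa tb.
  rewrite !raddfD /= !(mul0r, mulr0, mulr1, subr0, addr0, add0r).
  have sqr_le (p q : R) : `|p| <= `|q| -> p ^+ 2 <= q ^+ 2.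
    move=> pq; rewrite -[leLHS]real_normK ?num_real //.
    by rewrite -[leRHS]real_normK ?num_real // lerXn2r ?nnegrE.
  by apply: lerD; apply: sqr_le.
have y0E : y = y0 + a%:C *: delta_mx 0 k0 + b%:C *: ('i *: delta_mx 0 k0).
  apply/rowP => k; rewrite !mxE eqxx /=; have [->|_] := eqVneq k k0; last first.
    by rewrite !mulr0 !addr0.
  rewrite !mulr1 -addrA; apply/eqP; rewrite addrC -subr_eq -/c; apply/eqP.
  rewrite /a /b complexRe complexIm [_ * 'i]mulrC; exact: Crect.
rewrite y0E eq_on_segment => [|t tb]; last first.
  by have [_] := fd _ (near_y0 a t (lexx _) tb) k0.
rewrite eq_on_segment => [|t ta]; last first.
  have := near_y0 t 0 ta; rewrite normr0 scale0r addr0 => /(_ (normr_ge0 _)) /fd /(_ k0).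
  by case.
apply: IH => [|k mk].
  by have := near_y0 0 0; rewrite !normr0 !scale0r !addr0; apply.
by rewrite mxE; case: eqVneq => // kk0; apply: yx; rewrite ltn_neqAle mk andbT eq_sym.
Qed.

Lemma near_constant (f : vec -> R) (U : set vec) x : open U -> U x ->
  (forall y v, U y -> rderivable (fun y => (f y)%:C) y v) ->
  (forall y k, U y -> partial k (fun y => (f y)%:C) y = 0) ->
  \forall y \near x, f y = f x.
Proof.
move=> Uo Ux fd f0; have /nbhs_ballP[e /= e0 eU] : nbhs x U by exact: open_nbhs_nbhs.
apply/nbhs_ballP; exists e => //= y; apply: eq_on_polydisc => {}y /eU Uy k.
apply: real_wirtinger_eq0; [by move=> w; exact: fd|exact: f0].
Qed.

End LocallyConstant.

(** * Projective relation with a Hermitian metric and the conformal factor *)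

Section HermitianMetric.
Variables (R : realType) (n : nat) (M : complex_manifold R n).
Implicit Types (h : hermitian_metric M).

Lemma hnorm_sqrC h a z x : img a z ->
  ((hnorm h a z x) ^+ 2)%:C = sesquilinear (h a z) x x.
Proof.
move=> az; rewrite hnorm_sqr //; have [->|x0] := eqVneq x 0.
  by rewrite sesquilinear_mulmx mul0mx big1 // => j _; rewrite mxE mul0r.
have := hmx_posdef h az x0; case: sesquilinear => ? ?.
by rewrite ltcE /= => /andP[/eqP ->].
Qed.

Lemma hmx_unit h a z : img a z -> h a z \in unitmx.
Proof. by move=> az; apply: posdef_unitmx => x; exact: hmx_posdef. Qed.

Lemma hmx_rderivable h a z l m v : img a z ->
  rderivable (fun w => h a w l m) z v.
Proof. by move=> az; apply: smooth_rderivable az; exact: hmx_smooth. Qed.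

Lemma hnorm0 h a z : hnorm h a z 0 = 0.
Proof.
by rewrite /hnorm sesquilinear_mulmx mul0mx big1 ?sqrtr0 // => j _; rewrite mxE mul0r.
Qed.

End HermitianMetric.

Section ConformalMetrics.
Variables (R : realType) (n : nat) (M : complex_manifold R n).
Variables (h : hermitian_metric M) (F : tangent_function M R).

(** A constant factor has zero logarithmic derivative, so [spray] and [theta_star] do not change and
    [P = 0] serves. Nonvanishing of [F] excludes the constant [0]. *)
Lemma homothetic_projectively_related :
  (forall a z x, img a z -> x != 0 -> F a z x != 0) ->
  homothetic F (hnorm h) -> projectively_related F (hnorm h).
Proof.
move=> F0 [rho [Fh [c rhoc]]]; exists (fun _ _ _ => 0); split.
- by [].
- by move=> a; exact: smooth_cst0.
move=> a z x i az x0; rewrite mul0r addr0.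
have hF w : img a w -> forall y, F a w y ^+ 2 = c ^+ 2 * hnorm h a w y ^+ 2.
  by move=> aw y; rewrite Fh // rhoc exprMn.
have c0 : c != 0.
  by have := F0 a z x az x0; rewrite Fh // rhoc mulf_eq0 negb_or => /andP[].
have cd v : is_rderive z v (fun=> (c ^+ 2)%:C) 0 by exact: is_rderive_cst.
have ds k : partial k (fun _ : 'rV[R[i]]_n => (c ^+ 2)%:C) z = 0.
  by rewrite /partial /wirtinger !(rderive_val (cd _)) mulr0 subrr mul0r.
have hh w : img a w -> forall y, (hnorm h a w y ^+ 2)%:C = sesquilinear (h a w) y y.
  by move=> aw y; exact: hnorm_sqrC.
have c20 : c ^+ 2 != 0 by rewrite expf_neq0.
have hd l m v := hmx_rderivable h l m v az.
have hU := hmx_unit h az.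
have sd v := is_rderive_derivable (cd v).
rewrite (spray_conformal (s := fun=> c ^+ 2) (@img_open _ _ M a) az hh hF hU hd sd c20).
rewrite (theta_star_conformal (s := fun=> c ^+ 2) (@img_open _ _ M a) az hh hF hU hd sd c20).
rewrite !big1 ?(mul0r, mulr0, addr0, subr0, subrr) // => k _.
- by rewrite ds mul0r rmorph0 mul0r.
- by rewrite ds mul0r rmorph0 mulr0.
by rewrite ds !mul0r.
Qed.

Lemma projectively_related_partial0 (s : chart M -> 'rV[R[i]]_n -> R) :
  (2 <= n)%N ->
  (forall a z x, img a z -> F a z x ^+ 2 = s a z * hnorm h a z x ^+ 2) ->
  (forall a z v, img a z -> rderivable (fun w => (s a w)%:C) z v) ->
  (forall a z, img a z -> s a z != 0) ->
  projectively_related F (hnorm h) ->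
  forall a z k, img a z -> partial k (fun w => (s a w)%:C) z = 0.
Proof.
move=> n2 hF sd s0 [P [_ _ FP]] a z k az.
have hh w : img a w -> forall y, (hnorm h a w y ^+ 2)%:C = sesquilinear (h a w) y y.
  by move=> aw y; exact: hnorm_sqrC.
have hFa w (aw : img a w) y := hF a w y aw.
have hd l m v := hmx_rderivable h l m v az.
have hU := hmx_unit h az.
have sdz v := sd a z v az.
pose d k := partial k (fun w => (s a w)%:C) z / (s a z)%:C.
have S0 i : \sum_m invmx (h a z) m i * (d m)^*%R = 0.
  (* Here dimension at least two enters: [j] is [1] if [i] is [0], and [0] otherwise. *)
  have [j ji] : exists j : 'I_n, j != i.
    have [i0|i0] := eqVneq (i : nat) 0%N.
      by exists (Ordinal n2); rewrite -val_eqE /= i0.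
    by exists (Ordinal (ltnW n2)); rewrite -val_eqE /= eq_sym.
  pose x : 'rV[R[i]]_n := delta_mx 0 j.
  have xi : x 0 i = 0 by rewrite mxE eqxx eq_sym (negPf ji).
  have x0 : x != 0.
    by apply/eqP => /rowP/(_ j)/eqP; rewrite !mxE !eqxx oner_eq0.
  have := FP a z x i az x0.
  rewrite (spray_conformal (@img_open _ _ M a) az hh hFa hU hd sdz (s0 a z az)).
  rewrite (theta_star_conformal (@img_open _ _ M a) az hh hFa hU hd sdz (s0 a z az)).
  (* All multiples of [x], the one by [P] included, have zero [i]-th component; only the term with
     h(x, x) survives. *)
  rewrite xi !mulr0 !addr0 subr0 opprD addNKr -/d => /eqP.
  have Q0 : sesquilinear (h a z) x x != 0 by rewrite gt_eqF // hmx_posdef.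
  rewrite -[X in X == _]addr0 (inj_eq (addrI _)) eq_sym mulf_eq0 invr_eq0.
  by rewrite pnatr_eq0 /= oppr_eq0 mulf_eq0 (negPf Q0) orbF => /eqP.
(* [S0] says that this row is killed by the invertible matrix [invmx (h a z)]. *)
have d0 : \row_m (d m)^*%R = 0 :> 'rV[R[i]]_n.
  rewrite -[LHS](mulmxKV hU) [X in X *m _](_ : _ = 0) ?mul0mx //.
  apply/rowP => i; rewrite [LHS]mxE [RHS]mxE -[RHS](S0 i); apply: eq_bigr => m _.
  by rewrite [(\row__ _) _ _]mxE mulrC.
move/rowP: d0 => /(_ k)/eqP; rewrite !mxE conjC_eq0 /d mulf_eq0 invr_eq0.
by rewrite (negPf (sC_neq0 (s := s a) (s0 a z az))) orbF => /eqP.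
Qed.

End ConformalMetrics.

(** * The factor of the navigation data as a function on the manifold *)

Theorem corollary4p15 (R : realType) (n : nat) (n_ge2 : (2 <= n)%N)
    (M : complex_manifold R n) (M_connected : connected [set: M]%classic)
    (D : navigation_data M) (phi : R) (F : tangent_function M R)
    (F_solution : conformal_solution D phi F) :
  projectively_related F (hnorm (metric D)) <-> homothetic F (hnorm (metric D)).
Proof.
pose h := metric D; pose W a z := wind D a z.
(* Written without the square root of [hnorm], the squared length of the wind is built from
   derivable functions by sums, products and conjugation, even where the wind vanishes. *)
pose w2 a z := complex.Re (sesquilinear (h a z) (W a z) (W a z)).
pose eps a z := speed D (pt a z) ^+ 2 - w2 a z.
have w2E a z : img a z -> w2 a z = hnorm h a z (W a z) ^+ 2.
  by move=> az; rewrite hnorm_sqr.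
have speed_gt0 a z : img a z -> 0 < speed D (pt a z).
  by move=> az; apply: le_lt_trans (wind_lt_speed D az); exact: sqrtr_ge0.
have eps_gt0 a z : img a z -> 0 < eps a z.
  move=> az; rewrite /eps w2E // subr_gt0 ltrXn2r ?nnegrE ?sqrtr_ge0 ?ltW ?speed_gt0 //.
  exact: wind_lt_speed.
(* The two cases merge: without wind, [eps] is the square of the positive [speed], whose root is
   [speed] itself. *)
have FE a z x : img a z -> F a z x = (Num.sqrt (eps a z))^-1 * hnorm h a z x.
  move=> az; case: F_solution => [W0 ->//|_ _ ->//]; last by rewrite /eps w2E.
  by rewrite /eps w2E // /W W0 // hnorm0 expr0n subr0 sqrtr_sqr gtr0_norm ?speed_gt0.
have F2E a z x : img a z -> F a z x ^+ 2 = (eps a z)^-1 * hnorm h a z x ^+ 2.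
  by move=> az; rewrite FE // exprMn exprVn sqr_sqrtr // ltW ?eps_gt0.
have eps_derivable a z v : img a z -> rderivable (fun w => (eps a w)%:C) z v.
  move=> az; have Dspeed := is_rderiveP (smooth_rderivable v (@speed_smooth _ _ _ D a) az).
  have Dh i j := is_rderiveP (hmx_rderivable h i j v az).
  have DW i := is_rderiveP (smooth_rderivable v (@vf_smooth _ _ _ (wind D) a i) az).
  apply: is_rderive_derivable.
  rewrite (_ : (fun w => _) = fun w => (speed D (pt a w))%:C * (speed D (pt a w))%:C
    + - (w2 a w)%:C); last by apply/funext => w; rewrite rmorphB expr2 rmorphM.
  apply: is_rderiveD (is_rderiveM Dspeed Dspeed) (is_rderiveN _).
  apply: is_rderive_Re; apply: is_rderive_sum => i _; apply: is_rderive_sum => j _.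
  exact: is_rderiveM (is_rderiveM (Dh i j) (DW i)) (is_rderive_conj (DW j)).
split; last first.
  apply: homothetic_projectively_related => a z x az x0; rewrite FE //.
  rewrite mulf_neq0 ?invr_eq0 // gt_eqF ?sqrtr_gt0 ?eps_gt0 //.
  have := hmx_posdef h az x0; rewrite ltcE => /andP[_]; exact.
move=> rel.
have inv_derivable a z v : img a z -> rderivable (fun w => ((eps a w)^-1)%:C) z v.
  move=> az; apply: is_rderive_real_inv (is_rderiveP (eps_derivable a z v az)).
  by rewrite gt_eqF ?eps_gt0.
have inv_neq0 a z : img a z -> (eps a z)^-1 != 0.
  by move=> az; rewrite invr_eq0 gt_eqF ?eps_gt0.
have partial0 := projectively_related_partial0 n_ge2 F2E inv_derivable inv_neq0 rel.
have eps_transition a b z : overlap a b z -> eps b (transition a b z) = eps a z.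
  move=> abz; have [az bz] := abz; rewrite /eps /w2 /W vf_transition //.
  by rewrite hmx_transition // /transition /= coordK.
(* [homothetic] asks for a function on [M], so a chart is chosen at each point; [eps_transition]
   makes the value independent of the choice. *)
pose ch (p : M) : chart M := projT1 (cid (chart_cover p)).
have chP p : dom (ch p) p by rewrite /ch; case: cid.
pose e (p : M) : R := (eps (ch p) (Defs.coord (ch p) p))^-1.
have eE a z : img a z -> e (pt a z) = (eps a z)^-1.
  by move=> az; rewrite /e -(eps_transition a (ch (pt a z))) //; split => //; exact: chP.
have e_locally (p : M) : \forall q \near p, e q = e p.
  have ap := chP p; set a := ch p in ap; have az := coord_img ap.
  have near_z := near_constant (@img_open _ _ M a) az
    (fun y v => inv_derivable a y v) (fun y k => partial0 a y k).
  have near_p : \forall q \near p,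
      (eps a (Defs.coord a q))^-1 = (eps a (Defs.coord a p))^-1.
    exact: Defs.coord_continuous ap _ near_z.
  have near_dom : \forall q \near p, dom a q.
    by apply: open_nbhs_nbhs; split=> //; exact: dom_open.
  move: near_p near_dom; apply: filterS2 => q eq aq.
  (* The chart [a] of [p] stays fixed while the point varies, although [ch r] may be a different
     chart. *)
  have e_coord r : dom a r -> e r = (eps a (Defs.coord a r))^-1.
    by move=> ar; rewrite -{1}(coordK ar) eE //; exact: coord_img.
  by rewrite !e_coord.
have e_cst := locally_constant_connected M_connected e_locally.
exists (fun p => Num.sqrt (e p)); split.
  by move=> a z x az; rewrite eE // FE // sqrtrV // ltW ?eps_gt0.
(* The empty space also counts as connected here; any constant then works. *)
have [[p _]|M0] := pselect (exists p : M, True).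
  by exists (Num.sqrt (e p)) => q; rewrite (e_cst q p).
by exists 0 => p; case: M0; exists p.
Qed.
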